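(* If $G$ is a cycle-clique graph, then $\mathcal{E}(G)\geq 2\tau(G)$.
   Context: All graphs are finite, simple and undirected. The energy $\mathcal{E}(G)$ is the sum of the absolute values of all eigenvalues (with multiplicity) of the adjacency matrix $A(G)$. The vertex cover number $\tau(G)$ is the minimum cardinality of a set $X\subseteq V(G)$ such that every edge of $G$ has at least one endpoint in $X$. A block of $G$ is a maximal connected subgraph of $G$ that has no cut vertex (of its own). A graph $G$ is called a cycle-clique graph if each block of $G$ is either a cycle or a clique (complete graph; this includes a single edge $K_2$ and an isolated vertex $K_1$). *)

(* Defs.v *)
From mathcomp Require Import all_boot all_order all_algebra.

Set Implicit Arguments.
Unset Strict Implicit.
Unset Printing Implicit Defensive.

Import Order.TTheory GRing.Theory Num.Theory.
Local Open Scope ring_scope.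

Record sgraph := SGraph {
  vertex :> finType;
  edge : rel vertex;
  edge_sym : symmetric edge;
  edge_irrefl : irreflexive edge
}.

(* Subgraphs are not assumed to be induced. *)
Record subgraph (G : sgraph) := Subgraph {
  sub_vertex : {set G};
  sub_edge : rel G;
  sub_edge_sym : symmetric sub_edge;
  sub_edgeP : forall x y, sub_edge x y ->
    [&& x \in sub_vertex, y \in sub_vertex & edge x y]
}.

Section Subgraphs.

Variable G : sgraph.
Implicit Types (H K : subgraph G) (v x y : G).

Definition subgraph_le H K : Prop :=
  sub_vertex H \subset sub_vertex K /\ subrel (sub_edge H) (sub_edge K).

(* The graph with no vertex is not connected. *)
Definition connected H : Prop :=
  sub_vertex H != set0 /\
  {in sub_vertex H &, forall x y, connect (sub_edge H) x y}.

Definition edge_avoiding H v : rel G :=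
  [rel x y | [&& x != v, y != v & sub_edge H x y]].

(* v separates two other vertices of its component, equivalently deleting v
   increases the number of components. *)
Definition cut_vertex H v : Prop :=
  v \in sub_vertex H /\
  exists x y, [/\ x \in sub_vertex H :\ v, y \in sub_vertex H :\ v,
                  connect (sub_edge H) x y
                & ~~ connect (edge_avoiding H v) x y].

Definition nonseparable H : Prop :=
  connected H /\ forall v, ~ cut_vertex H v.

Definition block H : Prop :=
  nonseparable H /\
  forall K, nonseparable K -> subgraph_le H K -> subgraph_le K H.

Definition is_clique H : Prop :=
  {in sub_vertex H &, forall x y, x != y -> sub_edge H x y}.

Definition is_cycle H : Prop :=
  exists s : seq G,
    [/\ uniq s, (3 <= size s)%N, sub_vertex H = [set x in s]
      & {in s &, forall x y,
           sub_edge H x y = (y == next s x) || (x == next s y)}].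

Definition cycle_clique : Prop :=
  forall H, block H -> is_cycle H \/ is_clique H.

Definition vertex_cover (X : {set G}) : bool :=
  [forall x, forall y, edge x y ==> (x \in X) || (y \in X)].

Definition vertex_cover_number : nat :=
  #|[arg min_(X < [set: G] | vertex_cover X) #|X|]|.

End Subgraphs.

Arguments cycle_clique G : clear implicits.
Arguments vertex_cover_number G : clear implicits.

Section Energy.

Variable C : numClosedFieldType.

Definition adjacency (G : sgraph) : 'M[C]_#|G| :=
  \matrix_(i, j) (edge (enum_val i) (enum_val j))%:R.

(* The roots of the characteristic polynomial, listed with multiplicity. *)
Definition eigenvalues n (A : 'M[C]_n) : seq C :=
  sval (closed_field_poly_normal (char_poly A)).

Definition energy (G : sgraph) : C :=
  \sum_(a <- eigenvalues (adjacency G)) `|a|.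

End Energy.

(* Main.v *)
Require Import Defs.
From mathcomp Require Import all_boot all_order all_algebra.
From mathcomp Require Import zify ring.

(* By the spectral theorem, the energy of G is at least |tr (A X)| for every
   matrix X with |v X v^*| <= v v^* for all v.  Such test matrices on disjoint
   vertex sets combine into a block diagonal one, so it is enough to cut V(G)
   into pieces carrying a good X, whose vertex covers add up to a cover of G.
   Removing an end block B with attachment vertex u, together with u, leaves a
   graph whose covers extend to G by a minimum cover of B that also covers
   the edges leaving B, and this strips G into cliques and chordless cycles
   (or single isolated vertices).
   For a clique of order m, X = 2J/m - I gives tr (A X) = 2(m - 1).  For a
   cycle of length n, X is a circulant matrix: A/2 if n is even, and otherwise
   a rational approximation of the sign of A, which gives at least n + 1. *)

Set Implicit Arguments.
Unset Strict Implicit.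
Unset Printing Implicit Defensive.

(** * Inseparable vertex sets *)

Section Inseparable.

Variable G : sgraph.
Implicit Types (S W P D M : {set G}) (H K : subgraph G) (s : seq G).

(* Deleting w from the subgraph induced on W leaves no edge between the
   nonempty sets P and (W :\ w) :\: P. *)
Definition splits W (w : G) P : bool :=
  [&& P != set0, P \proper W :\ w
    & [forall x in P, forall y in (W :\ w) :\: P, ~~ edge x y]].

(** From three vertices on this implies connectedness: deleting a vertex outside a disconnected pair
    leaves a split. Sets of at most two vertices are always inseparable, even without an edge. *)
Definition inseparable W : bool :=
  [forall w in W, forall P : {set G}, ~~ splits W w P].

Lemma inseparableP W :
  reflect (forall w P, w \in W -> ~~ splits W w P) (inseparable W).
Proof.
apply: (iffP forall_inP) => [H w P /H/forallP/(_ P) // | H w wW].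
by apply/forallP=> P; apply: H.
Qed.

Lemma splitsI W w P x y :
  x \in P -> P \subset W :\ w -> y \in (W :\ w) :\: P ->
  (forall a b, a \in P -> b \in W :\ w -> edge a b -> b \in P) ->
  splits W w P.
Proof.
rewrite inE => xP PW /andP[yP yW] Pcl; apply/and3P; split.
- by apply/set0Pn; exists x.
- by apply/properP; split=> //; exists y.
- apply/forall_inP => a aP; apply/forall_inP => b; rewrite inE => /andP[bP bW].
  by apply: contra bP; apply: Pcl.
Qed.

Lemma splitsE W w P a b : splits W w P -> a \in P -> b \in W :\ w ->
  edge a b -> b \in P.
Proof.
case/and3P=> _ _ /forall_inP H aP bW ab; apply: contraLR ab => bP.
by have /forall_inP := H a aP; apply; rewrite inE bP.
Qed.

Lemma splitsC W w P : splits W w P -> splits W w ((W :\ w) :\: P).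
Proof.
move=> spl; have /and3P[/set0Pn[x xP] /properP[PW [y yW yP]] _] := spl.
apply: (@splitsI _ _ _ y x); rewrite ?subsetDl //.
- by rewrite in_setD yP.
- by rewrite in_setD (subsetP PW) // andbT in_setD xP.
- move=> a b; rewrite in_setD => /andP[aP aW] bW ab; rewrite in_setD bW andbT.
  by apply: contra aP => bP; apply: (splitsE spl bP); rewrite // edge_sym.
Qed.

(** Take [D] smallest among the nonempty sets joined to the rest of [S] through a single vertex [u]
    at most. A split of [u |: D] has a side avoiding [u], and that side would be a smaller such set,
    attached at [w]. *)
Lemma exists_terminal S : (1 < #|S|)%N ->
  exists u D, [/\ u \in S, D != set0, D \subset S :\ u,
    {in D & S :\: (u |: D), forall x y, ~~ edge x y} & inseparable (u |: D)].
Proof.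
move=> S1; pose good (p : G * {set G}) :=
  [&& p.1 \in S, p.2 != set0, p.2 \subset S :\ p.1 &
    [forall x in p.2, forall y in S :\: (p.1 |: p.2), ~~ edge x y]].
have /card_gt0P[u0 u0S] : (0 < #|S|)%N by apply: ltnW.
have good0 : good (u0, S :\ u0).
  rewrite /good /= u0S subxx /=; apply/andP; split.
    by rewrite -card_gt0; have := cardsD1 u0 S; rewrite u0S; lia.
  by apply/forall_inP => x _; rewrite setD1K // setDv; apply/forall_inP=> y; rewrite inE.
have [[u D] /and4P[/= uS D0 DS /forall_inP Dcl] Dmin] :=
  arg_minnP (fun p : G * {set G} => #|p.2|) good0.
exists u, D; split=> //.
  by move=> x y xD; apply/forall_inP: y; apply: Dcl.
set W := u |: D; have uD : u \notin D.
  by apply/negP => /(subsetP DS); rewrite !inE eqxx.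
have WS : W \subset S by rewrite subUset sub1set uS (subset_trans DS) ?subsetDl.
apply/inseparableP => w P wW; apply/negP => splP.
wlog uP : P splP / u \notin P.
  move=> H; have [uP|] := boolP (u \in P); last exact: H.
  by apply: (H _ (splitsC splP)); rewrite !inE uP.
have /and3P[P0 Pprop _] := splP.
have PD : P \subset D.
  apply/subsetP=> x xP; have := subsetP (proper_sub Pprop) x xP.
  by rewrite !inE => /andP[_ /predU1P[xu|//]]; rewrite -xu xP in uP.
have ltPD : (#|P| < #|D|)%N.
  have [wu|wu] := eqVneq w u.
    by apply: proper_card; rewrite wu setU1K in Pprop.
  have wD : w \in D by move: wW; rewrite !inE (negPf wu).
  apply: leq_ltn_trans (_ : (#|D :\ w| < _)%N); last by rewrite [ltnRHS](cardsD1 w) wD.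
  apply: subset_leq_card; rewrite subsetD1 PD /=.
  by apply/negP => /(subsetP (proper_sub Pprop)); rewrite !inE eqxx.
suff /Dmin /= : good (w, P) by rewrite leqNgt ltPD.
rewrite /good /= (subsetP WS) // P0 /=; apply/andP; split.
  exact: subset_trans (proper_sub Pprop) (setSD _ WS).
apply/forall_inP=> x xP; apply/forall_inP=> y; rewrite !inE negb_or -andbA.
move=> /and3P[yw yP yS]; apply: contra yP => xy.
have [yW|yW] := boolP (y \in W).
  by apply: (splitsE splP xP) xy; rewrite in_setD1 yw.
have /forall_inP/(_ y) := Dcl x (subsetP PD x xP).
by rewrite in_setD yW yS xy => /(_ isT).
Qed.

(** * Inseparable sets and blocks *)

Definition induced_edge W : rel G := fun x y => [&& x \in W, y \in W & edge x y].

Lemma induced_edge_sym W : symmetric (induced_edge W).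
Proof. by move=> x y; rewrite /induced_edge edge_sym andbCA. Qed.

Definition induced W : subgraph G :=
  @Subgraph G W _ (induced_edge_sym W) (fun _ _ => id).

Lemma connect_stable (T : finType) (e : rel T) (A : {pred T}) x y :
  (forall a b, a \in A -> e a b -> b \in A) -> connect e x y -> x \in A -> y \in A.
Proof.
move=> Acl /connectP[p + ->]; elim: p x => //= z p IHp x /andP[xz pz] xA.
exact: IHp pz (Acl _ _ xA xz).
Qed.

Lemma inseparable_nonseparable W :
  (2 < #|W|)%N -> inseparable W -> nonseparable (induced W).
Proof.
move=> W3 /inseparableP insW; split; first split=> /=.
- by rewrite -card_gt0; lia.
- move=> x y xW yW; apply: contraT => nxy.
  (* Delete a third vertex [w]: what remains of the component of [x] is split off from [y]. *)
  have /set0Pn[w] : W :\ x :\ y != set0.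
    by rewrite -card_gt0; have := cardsD1 x W; have := cardsD1 y (W :\ x); lia.
  rewrite !in_setD1 => /and3P[wy wx wW].
  pose P := [set z in W :\ w | connect (induced_edge W) x z].
  have /negP[] := insW w P wW; apply: (@splitsI _ _ _ x y).
  + by rewrite !inE eq_sym wx xW connect0.
  + by apply/subsetP => z; rewrite inE => /andP[].
  + by rewrite !inE (negPf nxy) andbF eq_sym wy.
  + move=> a b; rewrite !in_set -andbA => /and3P[aw aW xa] /andP[bw bW] ab.
    rewrite bw bW; apply: connect_trans xa (connect1 _).
    by rewrite /induced_edge aW bW.
- move=> v [/= vW [x [y [xW yW _ nxy]]]].
  pose P := [set z in W :\ v | connect (edge_avoiding (induced W) v) x z].
  have /negP[] := insW v P vW; apply: (@splitsI _ _ _ x y).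
  + by rewrite inE xW connect0.
  + by apply/subsetP => z; rewrite inE => /andP[].
  + by rewrite in_setD yW inE (negPf nxy) andbF.
  + move=> a b; rewrite in_set => /andP[aW xa] bW ab.
    rewrite in_set bW; apply: connect_trans xa (connect1 _).
    move: aW bW; rewrite !inE => /andP[av aW] /andP[bv bW].
    by apply/and3P; split=> //; apply/and3P.
Qed.

(** A split leaves no edge of [G] across it, hence none of [H], induced or not; the deleted vertex
    would then be a cut vertex of [H]. *)
Lemma nonseparable_inseparable H : nonseparable H -> inseparable (sub_vertex H).
Proof.
move=> [[_ Hc] Hcut]; apply/inseparableP => w P wH; apply/negP => spl.
have /and3P[/set0Pn[x xP] /properP[PH [y yH yP]] _] := spl.
have xH := subsetP PH x xP; case: (Hcut w); split=> //; exists x, y; split=> //.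
  by apply: Hc; [move: xH | move: yH]; rewrite in_setD1 => /andP[].
apply: contra yP => cxy; apply: (connect_stable _ cxy) => // a b aP /and3P[aw bw ab].
have /and3P[_ bH eab] := sub_edgeP ab.
by apply: (splitsE spl aP) eab; rewrite !inE bw.
Qed.

Lemma maxset_inseparable_block W :
  (2 < #|W|)%N -> maxset inseparable W -> block (induced W).
Proof.
move=> W3 /maxsetP[insW Wmax]; split; first exact: inseparable_nonseparable.
move=> K nsK [/= WK _]; have KW := Wmax _ (nonseparable_inseparable nsK) WK.
split; first by rewrite /= KW.
by move=> x y /= /sub_edgeP; rewrite /induced_edge KW.
Qed.

(** * Inseparable sets inside a chordless cycle *)

Definition cycle_seq s : Prop :=
  {in s &, forall x y, edge x y = (y == next s x) || (x == next s y)}.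

Lemma index_next z s x : uniq (z :: s) -> x \in z :: s ->
  index (next (z :: s) x) (z :: s) \in [:: 0; (index x (z :: s)).+1].
Proof.
move=> Uzs xs; rewrite next_nth xs; set i := index x _.
have [lti|lei] := ltnP i (size s); last by rewrite nth_default //= eqxx inE.
by rewrite -[nth z s i]/(nth z (z :: s) i.+1) index_uniq // !inE eqxx orbT.
Qed.

(** If [W] misses a vertex [z], cutting the cycle at [z] gives a path. A vertex [b] of [W] strictly
    between the first one [a] and the last one [c] then separates the part of [W] before [b] from
    the part after it. *)
Lemma inseparable_sub_cycle s W :
  uniq s -> cycle_seq s -> W \subset s -> inseparable W -> (2 < #|W|)%N ->
  W = [set x in s].
Proof.
move=> Us cs Ws /inseparableP insW W3; apply/eqP; rewrite eqEsubset.
apply/andP; split; first by apply/subsetP => x /(subsetP Ws); rewrite inE.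
apply/subsetP => z; rewrite inE => zs; apply: contraT => zW.
have [i t defs] := rot_to zs.
have Ut : uniq (z :: t) by rewrite -defs rot_uniq.
have {}Ws x : x \in W -> x \in z :: t by move/(subsetP Ws); rewrite -defs mem_rot.
have {}cs : {in z :: t &, forall x y,
    edge x y = (y == next (z :: t) x) || (x == next (z :: t) y)}.
  by move=> x y; rewrite -defs !mem_rot !next_rot //; apply: cs.
pose r x := index x (z :: t).
have r_inj : {in W &, injective r}.
  by move=> x y /Ws xW /Ws yW rxy; rewrite -(nth_index z xW) -/(r x) rxy nth_index.
have r_gt0 x : x \in W -> (0 < r x)%N.
  by rewrite /r /=; case: eqP => // zx xW; rewrite zx xW in zW.
have r_next x : x \in W -> r (next (z :: t) x) \in [:: 0; (r x).+1].
  by move/Ws; apply: index_next.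
have /card_gt0P[x0 x0W] : (0 < #|W|)%N by lia.
have [a aW amin] := @arg_minnP _ x0 [in W] r x0W.
have [c cW cmax] := @arg_maxnP _ x0 [in W] r x0W.
have /set0Pn[b] : W :\ a :\ c != set0.
  by rewrite -card_gt0; have := cardsD1 a W; have := cardsD1 c (W :\ a); lia.
rewrite !in_setD1 => /and3P[bc ba bW].
have lt_neq x y : x \in W -> y \in W -> x != y -> (r x <= r y)%N -> (r x < r y)%N.
  move=> xW yW xy; rewrite leq_eqVlt => /predU1P[/r_inj|//].
  by move=> /(_ xW yW) xy'; rewrite xy' eqxx in xy.
have /negP[] := insW b [set x in W | (r x < r b)%N] bW.
apply: (@splitsI _ _ _ a c).
- by rewrite inE aW lt_neq ?amin // eq_sym.
- apply/subsetP => x; rewrite !inE => /andP[-> ltx]; rewrite andbT.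
  by apply: contraTneq ltx => ->; rewrite ltnn.
- by rewrite !inE cW eq_sym bc -leqNgt /= andbT; apply: cmax.
- move=> x y; rewrite !inE => /andP[xW ltx] /andP[yb yW].
  rewrite cs ?Ws // yW => xy; rewrite andTb ltnNge; apply/negP.
  rewrite leq_eqVlt => /predU1P[/r_inj|lty].
    by move=> /(_ bW yW) yb'; rewrite yb' eqxx in yb.
  (* A step to the successor raises the rank by one or ends at rank 0, that is at [z], outside
     [W]. *)
  have := r_gt0 x xW; have := r_gt0 y yW.
  have := r_next x xW; have := r_next y yW; rewrite !inE.
  by case/orP: xy => /eqP <-; lia.
Qed.

(** A maximal inseparable set [M] containing [W] induces a block. In a clique every subset is a
    clique; in a cycle [W] must be the whole cycle. *)
Lemma inseparable_clique_or_cycle W :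
  cycle_clique G -> inseparable W -> (2 < #|W|)%N ->
  {in W &, forall x y, x != y -> edge x y} \/
  exists s, [/\ uniq s, 3 <= size s, W = [set x in s] & cycle_seq s].
Proof.
move=> ccG insW W3; have [M Mmax WM] := maxset_exists insW.
have M3 : (2 < #|M|)%N by apply: leq_trans W3 (subset_leq_card WM).
case: (ccG _ (maxset_inseparable_block M3 Mmax)) => [[s [Us s3 /= Ms sE]]|cl].
  right; exists s; have cs : cycle_seq s.
    move=> x y xs ys; rewrite -sE // /induced_edge.
    by rewrite Ms !inE xs ys.
  split=> //; apply: inseparable_sub_cycle => //.
  by apply/subsetP => x /(subsetP WM); rewrite Ms inE.
left=> x y xW yW xy.
by have /and3P[] := cl x y (subsetP WM x xW) (subsetP WM y yW) xy.
Qed.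

End Inseparable.

Import Order.TTheory GRing.Theory Num.Theory.
Local Open Scope ring_scope.

(** * Test matrices for the energy *)

Lemma char_poly_conjmx (R : comUnitRingType) n (P A : 'M[R]_n) :
  P \in unitmx -> char_poly (invmx P *m A *m P) = char_poly A.
Proof.
move=> Pu; pose Q := map_mx polyC P : 'M[{poly R}]_n.
have QV : map_mx polyC (invmx P) *m Q = 1%:M.
  by rewrite -map_mxM mulVmx // map_mx1.
have -> : char_poly (invmx P *m A *m P) =
    \det (map_mx polyC (invmx P) *m char_poly_mx A *m Q).
  rewrite /char_poly /char_poly_mx mulmxBr mulmxBl -!map_mxM.
  by rewrite mul_mx_scalar -scalemxAl QV scalemx1.
by rewrite !det_mulmx mulrAC -det_mulmx QV det1 mul1r.
Qed.

Lemma perm_eigenvalues (C : numClosedFieldType) n (P : 'M[C]_n) (d : 'rV[C]_n) :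
  P \in unitmx ->
  perm_eq (eigenvalues (invmx P *m diag_mx d *m P)) [seq d 0 i | i : 'I_n].
Proof.
move=> Pu; apply: prod_XsubC_eq; rewrite /eigenvalues.
case: closed_field_poly_normal => r /=.
rewrite (monicP (char_poly_monic _)) scale1r char_poly_conjmx // => <-.
rewrite char_poly_trig ?diag_mx_is_trig // big_image /=.
by apply: eq_bigr => i _; rewrite !mxE eqxx.
Qed.

(** Diagonalise [A] by a unitary [P]: the trace is the sum of the eigenvalues weighted by the form
    of [X] at the rows of [P]. These are unit vectors, so each weight has norm at most 1. *)
Lemma norm_trace_mulmx_le (C : numClosedFieldType) n (A X : 'M[C]_n) :
  A \is hermsymmx ->
  (forall v : 'I_n -> C,
     `|\sum_i \sum_j v i * X i j * (v j)^*| <= \sum_i `|v i| ^+ 2) ->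
  `|\tr (A *m X)| <= \sum_(a <- eigenvalues A) `|a|.
Proof.
move=> /hermitian_normalmx/orthomx_spectralP; set P := spectralmx A.
set d := spectral_diag A => defA Xle.
have Pun : P \is unitarymx by apply: spectral_unitarymx.
have Pu : P \in unitmx by apply: spectral_unit.
have -> : \tr (A *m X) = \sum_i d 0 i *
    (\sum_j \sum_k P i j * X j k * (P i k)^*).
  rewrite defA -!mulmxA mxtrace_mulC -!mulmxA; apply: eq_bigr => i _.
  rewrite mul_diag_mx mxE invmx_unitary // mulmxA mxE; congr (_ * _).
  under eq_bigr do rewrite !mxE big_distrl /=.
  by rewrite exchange_big.
rewrite (_ : eigenvalues A = eigenvalues (invmx P *m diag_mx d *m P)); last first.
  by rewrite -defA.
rewrite (perm_big _ (perm_eigenvalues d Pu)) big_image /=.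
apply: le_trans (ler_norm_sum _ _ _) _; apply: ler_sum => i _.
rewrite normrM ler_piMr //; apply: le_trans (Xle (P i)) _.
have /unitarymxP/matrixP/(_ i i) := Pun; rewrite !mxE eqxx => /= PPi.
rewrite -[leRHS]PPi.
by apply: ler_sum => j _; rewrite !mxE normCK.
Qed.

(** * Contractive matrices and their weights *)

Section Certificates.

Variables (C : numClosedFieldType) (G : sgraph).
Implicit Types (X Y : G -> G -> C) (v : G -> C) (W : {set G}).

Definition qform X v : C := \sum_x \sum_y v x * (v y)^* * X x y.

(* This forces X to vanish outside W * W, so such matrices on disjoint vertex
   sets add up to a block diagonal matrix. *)
Definition contractive W X : Prop :=
  forall v, `|qform X v| <= \sum_(x in W) `|v x| ^+ 2.

(** This is tr (A X), because the adjacency matrix A is symmetric. *)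
Definition weight X : C := \sum_x \sum_y (edge x y)%:R * X x y.

Lemma contractive0 W : contractive W (fun _ _ => 0).
Proof.
move=> v; rewrite /qform big1 ?normr0 ?sumr_ge0 // => x _; first by rewrite exprn_ge0.
by rewrite big1 // => y _; rewrite mulr0.
Qed.

Lemma contractiveD W1 W2 X Y : [disjoint W1 & W2] ->
  contractive W1 X -> contractive W2 Y ->
  contractive (W1 :|: W2) (fun x y => X x y + Y x y).
Proof.
move=> dW cX cY v; rewrite (eq_bigl _ _ (fun x => in_setU x W1 W2)) bigU //=.
apply: le_trans (lerD (cX v) (cY v)).
rewrite (_ : qform _ v = qform X v + qform Y v) ?ler_normD // /qform.
rewrite -big_split; apply: eq_bigr => x _ /=.
by rewrite -big_split; apply: eq_bigr => y _ /=; rewrite mulrDr.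
Qed.

Lemma weight0 : weight (fun _ _ => 0) = 0.
Proof. by rewrite /weight big1 // => x _; rewrite big1 // => y _; rewrite mulr0. Qed.

Lemma weightD X Y : weight (fun x y => X x y + Y x y) = weight X + weight Y.
Proof.
rewrite /weight -big_split; apply: eq_bigr => x _ /=.
by rewrite -big_split; apply: eq_bigr => y _ /=; rewrite mulrDr.
Qed.

Lemma norm_weight_le_energy X : contractive setT X -> `|weight X| <= energy C G.
Proof.
move=> cX; pose M : 'M[C]_#|G| := \matrix_(i, j) X (enum_val i) (enum_val j).
have sumE F : \sum_(x : G) F x = \sum_(i < #|G|) F (enum_val i) :> C.
  exact: (reindex _ (onW_bij _ (@enum_val_bij G))).
have -> : weight X = \tr (adjacency C G *m M).
  rewrite /weight exchange_big sumE; apply: eq_bigr => i _.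
  by rewrite sumE mxE; apply: eq_bigr => j _; rewrite !mxE edge_sym.
apply: norm_trace_mulmx_le.
  apply/is_hermitianmxP; rewrite expr0 scale1r; apply/matrixP=> i j.
  by rewrite !mxE rmorph_nat edge_sym.
move=> v; pose u x := v (enum_rank x); have := cX u.
rewrite /qform !sumE (eq_bigl _ _ (fun x => in_setT x)) sumE.
rewrite (eq_bigr (fun i => \sum_j v i * M i j * (v j)^*)).
  by under [X in _ <= X]eq_bigr do rewrite /u enum_valK.
move=> i _; rewrite sumE; apply: eq_bigr => j _.
by rewrite /u !enum_valK mxE mulrAC.
Qed.

(** The order on [C] is partial, but the hypotheses force [q] to be real, as half the difference of
    two nonnegative numbers. *)
Lemma ler_norm_pair (q N : C) : 0 <= N - q -> 0 <= N + q -> `|q| <= N.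
Proof.
move=> Nq0 qN0; have Rq : q \is Num.real.
  have -> : q = 2^-1 * ((N + q) - (N - q)) by field.
  by rewrite rpredM ?rpredV ?realn // rpredB ?ger0_real.
rewrite real_ler_norml //; apply/andP; split; last by rewrite -subr_ge0.
by rewrite -subr_ge0 opprK addrC.
Qed.

(** Cauchy-Schwarz, from expanding the sum of the squared distances to the mean [s / m]. *)
Lemma sqr_norm_sum_le W v :
  `|\sum_(x in W) v x| ^+ 2 <= #|W|%:R * \sum_(x in W) `|v x| ^+ 2.
Proof.
have [->|/set0Pn[a aW]] := eqVneq W set0.
  by rewrite !big_set0 normr0 mulr0 expr0n.
have m0 : 0 < #|W|%:R :> C by rewrite ltr0n; apply/card_gt0P; exists a.
set m := #|W|%:R in m0 *; set s := \sum_(x in W) v x.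
set N := \sum_(x in W) _.
have sW : \sum_(x in W) (v x)^* = s^* by rewrite raddf_sum.
have : 0 <= \sum_(x in W) `|v x - s / m| ^+ 2.
  by apply: sumr_ge0 => x _; rewrite exprn_ge0.
have -> : \sum_(x in W) `|v x - s / m| ^+ 2 = N - `|s| ^+ 2 / m.
  transitivity (\sum_(x in W) (`|v x| ^+ 2 - v x * (s^* / m) - (v x)^* * (s / m)
                               + s * s^* / m / m)).
    apply: eq_bigr => x _; rewrite !normCK rmorphB rmorphM fmorphV rmorph_nat.
    by field; rewrite gt_eqF.
  rewrite big_split /= !sumrB -!mulr_suml sW sumr_const -/s -/N normCK.
  by rewrite -mulr_natr -/m; field; rewrite gt_eqF.
by rewrite subr_ge0 ler_pdivrMr // mulrC.
Qed.

(* The reflection 2J/m - I. *)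
Definition clique_cert W : G -> G -> C := fun x y =>
  ((x \in W) && (y \in W))%:R * (2 / #|W|%:R - (x == y)%:R).

(** Stated for any [F] to serve both the quadratic form and the weight. *)
Lemma sum_clique_cert W (F : G -> G -> C) :
  \sum_x \sum_y F x y * clique_cert W x y =
  2 / #|W|%:R * (\sum_(x in W) \sum_(y in W) F x y) - \sum_(x in W) F x x.
Proof.
rewrite mulr_sumr -sumrB [RHS]big_mkcond; apply: eq_bigr => x _ /=.
case: ifP => xW; last first.
  by rewrite big1 // => y _; rewrite /clique_cert xW mul0r mulr0.
rewrite mulr_sumr [in RHS]big_mkcond /=.
rewrite (_ : F x x = \sum_y F x y * (x == y)%:R); last first.
  rewrite (bigD1 x) //= eqxx mulr1 big1 ?addr0 // => y /negPf.
  by rewrite eq_sym => ->; rewrite mulr0.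
rewrite -sumrB; apply: eq_bigr => y _; rewrite /clique_cert xW /=.
case: ifP => [yW|yW]; first by rewrite mul1r; ring.
by rewrite mul0r mulr0 sub0r; case: eqP yW => [<-|]; rewrite ?xW ?mulr0 ?oppr0.
Qed.

Lemma clique_cert_contractive W : W != set0 -> contractive W (clique_cert W).
Proof.
rewrite -card_gt0 -(ltr0n C) => m0 v; rewrite /qform sum_clique_cert.
set m := #|W|%:R in m0 *; set N := \sum_(x in W) `|v x| ^+ 2.
have -> : \sum_(x in W) v x * (v x)^* = N.
  by apply: eq_bigr => x _; rewrite normCK.
have -> : \sum_(x in W) \sum_(y in W) v x * (v y)^* = `|\sum_(x in W) v x| ^+ 2.
  by rewrite normCK raddf_sum mulr_suml; apply: eq_bigr => x _; rewrite mulr_sumr.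
have := sqr_norm_sum_le W v; rewrite -/m -/N; set s := `|_| ^+ 2 => sN.
have s0 : 0 <= s by rewrite exprn_ge0.
apply: ler_norm_pair.
  have -> : N - (2 / m * s - N) = 2 / m * (m * N - s) by field; rewrite gt_eqF.
  by rewrite mulr_ge0 ?subr_ge0 // divr_ge0 // ltW.
by rewrite addrC subrK mulr_ge0 // divr_ge0 // ltW.
Qed.

Lemma weight_clique_cert W : W != set0 ->
  {in W &, forall x y, x != y -> edge x y} ->
  weight (clique_cert W) = (2 * #|W|.-1)%:R.
Proof.
rewrite -card_gt0 => m0 Wcl; rewrite /weight sum_clique_cert.
rewrite [X in _ - X]big1 ?subr0 => [|x _]; last by rewrite edge_irrefl.
rewrite (eq_bigr (fun=> #|W|.-1%:R)) => [|x xW].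
  rewrite sumr_const -mulr_natr natrM; field.
  by rewrite pnatr_eq0 -lt0n.
rewrite (bigD1 x) //= edge_irrefl add0r (eq_bigr (fun=> 1)) => [|y /andP[yW yx]].
  rewrite sumr_const (cardD1 x W) xW; congr _%:R.
  by apply: eq_card => y; rewrite !inE andbC.
by rewrite Wcl // eq_sym.
Qed.

End Certificates.

(** * Test matrices on cycles *)

Section CycleCertificates.

Variables (C : numClosedFieldType) (G : sgraph) (s : seq G).
Hypothesis Us : uniq s.
Local Notation f := (next s).
Implicit Types (c : seq C) (v : G -> C).

Lemma iter_next_neq k x :
  x \in s -> (0 < k < size s)%N -> iter k f x != x.
Proof.
move=> xs /andP[k0 ks]; apply/eqP => fx.
have ord : fingraph.order f x = size s.
  by apply: order_cycle => //; apply: cycle_next.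
have := @findex_iter _ f x k; rewrite ord fx => /(_ ks).
by rewrite findex0 => k0'; rewrite -k0' in k0.
Qed.

Lemma sum_next (F : G -> C) : \sum_(x in s) F (f x) = \sum_(x in s) F x.
Proof.
rewrite [RHS](reindex f) /=; last first.
  by exists (prev s) => x _; rewrite ?prev_next ?next_prev.
by apply: eq_bigl => x; rewrite mem_next.
Qed.

(* Each of the two bounds only has to hold up to a coboundary of the rotation. *)
Lemma norm_sum_le_next (q N F1 F2 : G -> C) :
  (forall x, x \in s -> 0 <= N x - q x + (F1 (f x) - F1 x)) ->
  (forall x, x \in s -> 0 <= N x + q x + (F2 (f x) - F2 x)) ->
  `|\sum_(x in s) q x| <= \sum_(x in s) N x.
Proof.
move=> H1 H2; apply: ler_norm_pair.
  have := sumr_ge0 (index_enum G) H1.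
  by rewrite big_split /= !sumrB (sum_next F1) subrr addr0.
have := sumr_ge0 (index_enum G) H2.
by rewrite !big_split /= sumrN (sum_next F2) subrr addr0.
Qed.

(** The circulant matrix summing c_k (R^k + R^-k), where R is the rotation of the cycle. The term k
    = 0 counts twice and puts 2 c_0 on the diagonal; coefficients beyond the list default to 0. *)
Definition cycle_cert c : G -> G -> C := fun x y =>
  \sum_(k < 4) c`_k * (((x \in s) && (y == iter k f x))%:R
                     + ((y \in s) && (x == iter k f y))%:R).

Lemma sum_cycle_cert c (F : G -> G -> C) :
  \sum_x \sum_y F x y * cycle_cert c x y =
  \sum_(x in s) \sum_(k < 4) c`_k * (F x (iter k f x) + F (iter k f x) x).
Proof.
have pairE k (H : G -> G -> C) :
    \sum_x \sum_y H x y * ((x \in s) && (y == iter k f x))%:R =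
    \sum_(x in s) H x (iter k f x).
  rewrite [RHS]big_mkcond; apply: eq_bigr => x _ /=; case: ifP => xs /=.
    rewrite (bigD1 (iter k f x)) //= eqxx mulr1 big1 ?addr0 // => y /negPf ->.
    by rewrite mulr0.
  by rewrite big1 // => y _; rewrite mulr0.
transitivity (\sum_(k < 4) c`_k *
    (\sum_x \sum_y F x y * ((x \in s) && (y == iter k f x))%:R +
     \sum_y \sum_x F x y * ((y \in s) && (x == iter k f y))%:R)).
  under [RHS]eq_bigr do rewrite [X in _ * (_ + X)]exchange_big -big_split /= mulr_sumr.
  rewrite [RHS]exchange_big; apply: eq_bigr => x _ /=.
  under [RHS]eq_bigr do rewrite -big_split /= mulr_sumr.
  rewrite [RHS]exchange_big; apply: eq_bigr => y _ /=.
  by rewrite mulr_sumr; apply: eq_bigr => k _; ring.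
rewrite [RHS]exchange_big; apply: eq_bigr => k _ /=.
by rewrite pairE (pairE k (fun y x => F x y)) -big_split mulr_sumr.
Qed.

Lemma weight_cycle_cert c :
  {in s, forall x, edge x (f x)} ->
  (forall k : 'I_4, k != 1 :> nat -> c`_k != 0 ->
     {in s, forall x, ~~ edge x (iter k f x)}) ->
  weight (cycle_cert c) = (2 * size s)%:R * c`_1.
Proof.
move=> sE sNE; rewrite /weight sum_cycle_cert.
rewrite (eq_bigr (fun=> c`_1 *+ 2)) => [|x xs].
  by rewrite sumr_const (card_uniqP Us) -mulrnA mulr_natl.
rewrite (bigD1 (inord 1)) //= !inordK //= [edge (f x) x]edge_sym sE //.
rewrite big1 => [|k k1]; first by rewrite addr0 -mulr2n mulr_natr.
have [->|ck] := eqVneq c`_k 0; first by rewrite mul0r.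
have {}k1 : k != 1 :> nat.
  by apply: contra_neq k1 => k1; apply: val_inj; rewrite /= inordK.
by rewrite [edge (iter k f x) x]edge_sym (negPf (sNE k k1 ck x xs)) addr0 mulr0.
Qed.

Lemma cycle_cert_contractive c (W : {set G}) : W =i s ->
  (forall v,
    `|\sum_(x in s) \sum_(k < 4) c`_k *
       (v x * (v (iter k f x))^* + v (iter k f x) * (v x)^*)|
    <= \sum_(x in s) v x * (v x)^*) ->
  contractive W (cycle_cert c).
Proof.
move=> Ws H v; rewrite /qform sum_cycle_cert (eq_bigl _ _ Ws).
by under [leRHS]eq_bigr do rewrite normCK; apply: H.
Qed.

(** * Certificates for even cycles, long odd cycles and the pentagon *)

Definition even_cert := cycle_cert [:: 0; 2^-1].

Lemma even_cert_contractive (W : {set G}) : W =i s -> contractive W even_cert.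
Proof.
move=> Ws; apply: cycle_cert_contractive => // v.
(* Shifting half of |v x|^2 to the next vertex makes the two sides half the squared norms of v (f x)
   - v x and v (f x) + v x. *)
pose F x := 2^-1 * (v x * (v x)^*).
apply: (norm_sum_le_next (F1 := F) (F2 := F)) => x _;
  rewrite !big_ord_recl big_ord0 /= /F.
- rewrite [leRHS](_ : _ = 2^-1 * ((v (f x) - v x) * (v (f x) - v x)^*)).
    by rewrite mulr_ge0 ?mul_conjC_ge0 ?invr_ge0 ?ler0n.
  by rewrite rmorphB; field.
- rewrite [leRHS](_ : _ = 2^-1 * ((v (f x) + v x) * (v (f x) + v x)^*)).
    by rewrite mulr_ge0 ?mul_conjC_ge0 ?invr_ge0 ?ler0n.
  by rewrite rmorphD; field.
Qed.

(** With A = R + R^-1, A^3 = R^3 + R^-3 + 3 A, so the coefficient of R in 9/10 A - 27/250 A^3 is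
    9/10 - 81/250 = 72/125. *)
Definition odd_cert := cycle_cert [:: 0; 72 / 125; 0; - (27 / 250)].

(* With A the adjacency matrix of the cycle, the certificate is
   X = 9/10 A - 27/250 A^3, and
   I - X = 27/250 ((A - 5/3)^2 (A + 2) + 4/3 (A - 5/3)^2)
   is positive semidefinite because A + 2 is; changing A into - A handles
   I + X.  Below u and p are the images of v by A - 5/3 and by a square root
   of (A - 5/3)^2 (A + 2). *)
Lemma odd_cert_contractive (W : {set G}) : W =i s -> contractive W odd_cert.
Proof.
move=> Ws; apply: cycle_cert_contractive => // v.
(* This coboundary turns the operator identity into a pointwise one; comparing coefficients from
   [w3] down to [w0] determines it. The sign [e] sits on products at odd distance, which change sign
   with A. *)
pose F (e : C) x :=
  let w i := v (iter i f x) in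
  187 / 250 * (w 0%N * (w 0%N)^*) + 3 / 10 * (w 1%N * (w 1%N)^*)
  + 27 / 250 * (w 2%N * (w 2%N)^*)
  + e * (33 / 125 * (w 0%N * (w 1%N)^* + w 1%N * (w 0%N)^*)
         + 9 / 125 * (w 1%N * (w 2%N)^* + w 2%N * (w 1%N)^*))
  - 9 / 125 * (w 0%N * (w 2%N)^* + w 2%N * (w 0%N)^*).
apply: (norm_sum_le_next (F1 := F (-1)) (F2 := F 1)) => x _;
  rewrite !big_ord_recl big_ord0 /= /F /=;
  set w0 := v x; set w1 := v (f x); set w2 := v (f (f x)); set w3 := v (f (f (f x))).
- pose u := w2 - 5 / 3 * w1 + w0; pose p := w3 - 2 / 3 * w2 - 2 / 3 * w1 + w0.
  rewrite [leRHS](_ : _ = 27 / 250 * (p * p^* + 4 / 3 * (u * u^*))).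
    by rewrite !(mul_conjC_ge0, invr_ge0, ler0n, addr_ge0, mulr_ge0).
  rewrite /u /p !(rmorphD, rmorphN, rmorphM, fmorphV, rmorph_nat) /=.
  by field.
- pose u := w2 + 5 / 3 * w1 + w0; pose p := w3 + 2 / 3 * w2 - 2 / 3 * w1 - w0.
  rewrite [leRHS](_ : _ = 27 / 250 * (p * p^* + 4 / 3 * (u * u^*))).
    by rewrite !(mul_conjC_ge0, invr_ge0, ler0n, addr_ge0, mulr_ge0).
  rewrite /u /p !(rmorphD, rmorphN, rmorphM, fmorphV, rmorph_nat) /=.
  by field.
Qed.

(** The diagonal entry is 1/5, twice the listed value. The eigenvalues are 1 on constant vectors and
    plus or minus 2 / sqrt 5 elsewhere. *)
Definition pentagon_cert := cycle_cert [:: 10^-1; 3 / 5; - 5^-1].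

(* On the 5-cycle, X := pentagon_cert satisfies I - X^2 = (I - J/5) / 5, hence
   2 (I - X) = (I - X)^2 + (I - J/5) / 5 >= 0 and likewise for I + X. *)
Lemma pentagon_cert_contractive (W : {set G}) :
  size s = 5 -> W =i s -> contractive W pentagon_cert.
Proof.
move=> s5 Ws; apply: cycle_cert_contractive => // v.
(* Naming the five vertices as iterates of one of them reduces the claim to an inequality in five
   complex numbers. *)
have [x fx sumE] : exists2 x, iter 5 f x = x & forall H : G -> C,
    \sum_(y in s) H y = \sum_(i < 5) H (iter i f x).
  move: f (cycle_next Us) => g; case: s Us s5 => [|a [|b [|c [|d [|e []]]]]] //.
  move=> Us5 _ /and5P[/eqP ga /eqP gb /eqP gc /eqP gd /andP[/eqP ge _]].
  exists a => [|H]; first by rewrite /= ga gb gc gd ge.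
  by rewrite -big_uniq // !big_cons big_nil !big_ord_recl big_ord0 /= ga gb gc gd.
move: fx; rewrite !sumE !big_ord_recl !big_ord0 /= => fx; rewrite !fx.
move: (v x) (v (f x)) (v (f (f x))) (v (f (f (f x)))) (v (f (f (f (f x))))).
move=> w0 w1 w2 w3 w4.
pose sq (z : C) := z * z^*.
have sq_ge0 z : 0 <= sq z by apply: mul_conjC_ge0.
pose X (a b c d e : C) : C := (a + 3 * (b + e) - (c + d)) / 5.
(* The pairwise differences give the form of 5I - J, so [V / 25] is that of (I - J/5) / 5, and [S e]
   is half of (I + eX)^2 plus it, for e = 1 or -1. *)
pose V := sq (w0 - w1) + sq (w0 - w2) + sq (w0 - w3) + sq (w0 - w4)
  + sq (w1 - w2) + sq (w1 - w3) + sq (w1 - w4) + sq (w2 - w3) + sq (w2 - w4)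
  + sq (w3 - w4).
pose S e := (sq (w0 + e * X w0 w1 w2 w3 w4) + sq (w1 + e * X w1 w2 w3 w4 w0)
  + sq (w2 + e * X w2 w3 w4 w0 w1) + sq (w3 + e * X w3 w4 w0 w1 w2)
  + sq (w4 + e * X w4 w0 w1 w2 w3) + V / 25) / 2.
have S_ge0 e : 0 <= S e.
  by rewrite !(sq_ge0, invr_ge0, ler0n, addr_ge0, mulr_ge0).
apply: ler_norm_pair.
- rewrite [leRHS](_ : _ = S (-1)) //.
  rewrite /S /V /X /sq !(rmorphD, rmorphN, rmorphM, fmorphV, rmorph_nat, rmorph1) /=.
  by field.
- rewrite [leRHS](_ : _ = S 1) //.
  rewrite /S /V /X /sq !(rmorphD, rmorphN, rmorphM, fmorphV, rmorph_nat, rmorph1) /=.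
  by field.
Qed.
End CycleCertificates.

(** * Decomposition into cliques and cycles *)

Section CyclePieces.

Variables (C : numClosedFieldType) (G : sgraph) (s : seq G).
Hypotheses (Us : uniq s) (cs : cycle_seq s).
Local Notation f := (next s).

Lemma edge_next : {in s, forall x, edge x (f x)}.
Proof. by move=> x xs; rewrite cs ?mem_next // eqxx. Qed.

Lemma mem_iter_next k x : (iter k f x \in s) = (x \in s).
Proof. by elim: k => //= k <-; rewrite mem_next. Qed.

Lemma edge_iter_next k x : x \in s ->
  (1 < k)%N -> (k.+1 < size s)%N -> ~~ edge x (iter k f x).
Proof.
case: k => // k xs k1 ks; rewrite cs ?mem_iter_next // -iterS negb_or.
rewrite [x == _]eq_sym !iter_next_neq // ?ltnS ?andbT.
by rewrite iterSr iter_next_neq ?mem_next //; lia.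
Qed.

(** For n even the weight is n. For n odd, 144 n / 125 reaches n + 1 only from n = 7 on; at n = 5
    the pentagon certificate gives exactly 6. *)
Lemma cycle_certificate (W : {set G}) : W =i s -> (3 < size s)%N ->
  exists2 X : G -> G -> C, contractive W X & (2 * uphalf (size s))%:R <= weight X.
Proof.
move=> Ws s4; have [even_s|odd_s] := boolP (~~ odd (size s)).
  exists (even_cert C s); first exact: even_cert_contractive.
  rewrite weight_cycle_cert //; last first.
  - by case=> [[|[|[|[|k]]]]] //= _ _; rewrite eqxx.
  - exact: edge_next.
  by rewrite /= ler_pdivlMr ?ltr0n // -natrM ler_nat; lia.
have [s5|s5] := eqVneq (size s) 5.
  exists (pentagon_cert C s); first exact: pentagon_cert_contractive.
  rewrite weight_cycle_cert //; last first.
  - case=> [[|[|[|[|k]]]]] //= _ _ ck x xs; rewrite ?edge_irrefl //.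
      exact: (@edge_iter_next 2).
    by rewrite eqxx in ck.
  - exact: edge_next.
  by rewrite s5 /=; rewrite mulrA ler_pdivlMr ?ltr0n // -!natrM ler_nat.
exists (odd_cert C s); first exact: odd_cert_contractive.
rewrite weight_cycle_cert //; last first.
- case=> [[|[|[|[|k]]]]] //= _ _ ck x xs; rewrite ?edge_irrefl //.
    by rewrite eqxx in ck.
  by apply: (@edge_iter_next 3) => //; lia.
- exact: edge_next.
by rewrite /= mulrA ler_pdivlMr ?ltr0n // -!natrM ler_nat; lia.
Qed.

(** Take every second vertex, starting from [u]; for odd length the last one taken is the
    predecessor of [u]. Containing [u] lets the cover also handle edges that leave the cycle at
    [u]. *)
Lemma cycle_cover u : u \in s -> exists2 T : {set G},
  u \in T /\ (#|T| <= uphalf (size s))%N &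
  {in s &, forall x y, edge x y -> (x \in T) || (y \in T)}.
Proof.
move=> us; have fs := cycle_next Us; set n := size s.
have n0 : (0 < n)%N by rewrite lt0n size_eq0; apply: contraTneq us => ->.
pose T := [set iter i.*2 f u | i : 'I_(uphalf n)].
have memT k : (k < n)%N -> ~~ odd k -> iter k f u \in T.
  move=> kn ek; have k2 : (k./2 < uphalf n)%N by lia.
  by apply/imsetP; exists (Ordinal k2) => //=; rewrite even_halfK.
have uT : u \in T by apply: (memT 0%N).
have ord : fingraph.order f u = n by apply: order_cycle.
have iter_n : iter n f u = u by rewrite -ord; apply: (iter_order_cycle fs).
have TorT x : x \in s -> (x \in T) || (f x \in T).
  move=> xs; have ux : fconnect f u x by rewrite (fconnect_cycle fs us).
  rewrite -(iter_findex ux); have := findex_max ux; rewrite ord.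
  move: (findex f u x) => k kn; have [ok|ek] := boolP (odd k); last by rewrite memT.
  rewrite -iterS; have [->|k1] := eqVneq k.+1 n; first by rewrite iter_n uT orbT.
  by rewrite (memT k.+1) ?orbT //= ?ok //; lia.
exists T; first split=> //.
  by apply: leq_trans (leq_imset_card _ _) _; rewrite card_ord.
by move=> x y xs ys; rewrite cs // => /orP[] /eqP->; rewrite ?TorT // orbC TorT.
Qed.

End CyclePieces.

Lemma triangle_clique (G : sgraph) (s : seq G) : uniq s -> size s = 3 ->
  cycle_seq s -> {in s &, forall x y, x != y -> edge x y}.
Proof.
move=> Us s3 cs x y xs ys; rewrite cs //; move: Us s3 xs ys {cs}.
case: s => [|a [|b [|c []]]] //= /and3P[]; rewrite !inE !negb_or.
move=> /andP[ab ac] bc _ _ /or3P[]/eqP-> /or3P[]/eqP->; rewrite ?eqxx //= => _;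
  rewrite ?[b == a]eq_sym ?[c == a]eq_sym ?[c == b]eq_sym ?(negPf ab) ?(negPf ac)
    ?(negPf bc) ?eqxx ?orbT //.
Qed.

(** * Stripping pieces off the graph *)

Section Decomposition.

Variables (C : numClosedFieldType) (G : sgraph).
Hypothesis ccG : cycle_clique G.
Implicit Types S B T W D : {set G}.

(** [T] covers every edge of [S] that meets [B], including those leaving [B], so only edges inside
    [S :\: B] remain to be covered once [B] is removed. *)
Definition piece S B : Prop :=
  exists2 T : {set G}, {in B & S, forall x y, edge x y -> (x \in T) || (y \in T)} &
  exists2 X : G -> G -> C, contractive B X & (2 * #|T|)%:R <= weight X.

Lemma piece_isolated S x :
  {in S, forall y, ~~ edge x y} -> piece S [set x].
Proof.
move=> isox; exists set0; first by move=> _ y /set1P-> /isox/negPf->.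
exists (fun _ _ => 0); first exact: contractive0.
by rewrite weight0 cards0.
Qed.

(** The cover omits one vertex [d] of [D]: all neighbours of [d] in [S] lie in the clique, and the
    weight is twice the size of the cover. *)
Lemma piece_clique S u D : D != set0 -> u \notin D ->
  {in D & S :\: (u |: D), forall x y, ~~ edge x y} ->
  {in u |: D &, forall x y, x != y -> edge x y} -> piece S (u |: D).
Proof.
move=> /set0Pn[d dD] uD Dcl cl; set W := u |: D.
have dW : d \in W by rewrite !inE dD orbT.
have W0 : W != set0 by apply/set0Pn; exists d.
exists (W :\ d).
  move=> x y xW yS xy; rewrite !in_setD1 xW andbT.
  have [xd|//] := eqVneq x d; have [yW|yW] := boolP (y \in W).
    by rewrite andbT; apply: contraTneq xy => ->; rewrite xd edge_irrefl.
  by have := Dcl d y dD; rewrite in_setD yW yS -xd xy => /(_ isT).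
exists (clique_cert C W); first exact: clique_cert_contractive.
by rewrite weight_clique_cert // (cardsD1 d W) dW.
Qed.

(** Edges of [S] leaving the cycle start at [u], so a cover of the cycle through [u] covers them
    too. *)
Lemma piece_cycle S u D s :
  {in D & S :\: (u |: D), forall x y, ~~ edge x y} ->
  uniq s -> (3 < size s)%N -> cycle_seq s -> u |: D =i s -> piece S (u |: D).
Proof.
move=> Dcl Us s4 cs Ws; set W := u |: D in Ws Dcl *.
have us : u \in s by rewrite -Ws setU11.
have [T [uT sT] Tcov] := cycle_cover Us cs us.
exists T.
  move=> x y xW yS xy; have [yW|yW] := boolP (y \in W).
    by apply: Tcov; rewrite -?Ws.
  have /setU1P[->|xD] := xW; first by rewrite uT.
  by have := Dcl x y xD; rewrite in_setD yW yS xy => /(_ isT).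
have [X cX wX] := cycle_certificate C Us cs Ws s4; exists X => //.
by apply: le_trans wX; rewrite ler_nat leq_mul2l sT.
Qed.

Lemma exists_piece S : S != set0 ->
  exists2 B, B != set0 /\ B \subset S & piece S B.
Proof.
rewrite -card_gt0 => S0; have set1_0 (x : G) : [set x] != set0.
  by apply/set0Pn; exists x; rewrite set11.
have [S1|S1] := leqP #|S| 1.
  have /cards1P[x ->] : #|S| == 1%N by lia.
  exists [set x] => //; apply: piece_isolated => y /set1P->.
  by rewrite edge_irrefl.
have [u [D [uS D0 DS Dcl insW]]] := exists_terminal S1; set W := u |: D in insW.
have uD : u \notin D by apply/negP=> /(subsetP DS); rewrite !inE eqxx.
have WS : W \subset S by rewrite subUset sub1set uS (subset_trans DS) ?subsetDl.
have W0 : W != set0 by apply/set0Pn; exists u; rewrite setU11.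
have [W2|W3] := leqP #|W| 2.
  have /cards1P[d defD] : #|D| == 1%N.
    by move: W2 D0; rewrite cardsU1 uD -card_gt0; lia.
  (* A two-element inseparable set may lack its edge; then [d] has no neighbour in [S] and is
     removed alone. *)
  have [ud|ud] := boolP (edge u d).
    exists W => //; apply: piece_clique => // x y.
    by rewrite /W defD !inE => /orP[]/eqP-> /orP[]/eqP->; rewrite ?eqxx // edge_sym.
  exists [set d]; first by rewrite sub1set (subsetP WS) // /W defD !inE eqxx orbT.
  apply: piece_isolated => y yS; have [yW|yW] := boolP (y \in W).
    move: yW; rewrite /W defD !inE => /orP[]/eqP->; last by rewrite edge_irrefl.
    by rewrite edge_sym.
  by apply: Dcl; rewrite ?in_setD ?yW // defD set11.
exists W => //.
have [cl|[s [Us s3 Ws cs]]] := inseparable_clique_or_cycle ccG insW W3.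
  exact: piece_clique.
have {}Ws : W =i s by move=> x; rewrite Ws inE.
(* A triangle is handled as a clique. *)
have [s4|s4] := leqP (size s) 3; last exact: piece_cycle Ws.
apply: piece_clique => // x y; rewrite !Ws => xs ys.
by apply: (triangle_clique Us); rewrite //; lia.
Qed.

(** Induction on the size of [S]: covers are united, and certificates are added because [B] and
    [S :\: B] are disjoint. *)
Lemma exists_certificate S : exists2 T : {set G},
  {in S &, forall x y, edge x y -> (x \in T) || (y \in T)} &
  exists2 X : G -> G -> C, contractive S X & (2 * #|T|)%:R <= weight X.
Proof.
have [n] := ubnP #|S|; elim: n S => // n IHn S; rewrite ltnS => Sn.
have [->|S0] := eqVneq S set0.
  exists set0; first by move=> x y; rewrite inE.
  by exists (fun _ _ => 0); [apply: contractive0 | rewrite weight0 cards0].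
have [B [B0 BS] [T Tcov [X cX wX]]] := exists_piece S0.
have [|T' T'cov [X' cX' wX']] := IHn (S :\: B).
  by move: B0; rewrite cardsDS // -card_gt0; have := subset_leq_card BS; lia.
exists (T :|: T').
  move=> x y xS yS xy; rewrite !in_setU.
  have [xB|xB] := boolP (x \in B).
    by have /orP[] := Tcov x y xB yS xy => ->; rewrite ?orbT.
  have [yB|yB] := boolP (y \in B).
    by have := Tcov y x yB xS; rewrite edge_sym => /(_ xy) /orP[] ->; rewrite ?orbT.
  have /orP[] : (x \in T') || (y \in T') by apply: T'cov; rewrite ?in_setD ?xB ?yB.
    by move->; rewrite orbT.
  by move->; rewrite !orbT.
exists (fun x y => X x y + X' x y).
  rewrite -[S](setID S B) (setIidPr BS); apply: contractiveD => //.
  by rewrite -setI_eq0 setIDA setDIl setDv set0I.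
rewrite weightD; apply: le_trans (lerD wX wX').
by rewrite -natrD ler_nat -mulnDr leq_mul2l cardsU leq_subr.
Qed.

End Decomposition.

Theorem theorem3p2 (C : numClosedFieldType) (G : sgraph) :
  cycle_clique G -> (2 * vertex_cover_number G)%:R <= energy C G.
Proof.
move=> ccG; have [T Tcov [X cX wX]] := exists_certificate C ccG [set: G].
apply: le_trans (norm_weight_le_energy cX).
(* The lower bound makes the weight real and nonnegative, so it equals its norm. *)
have wX0 : 0 <= weight X by apply: le_trans wX; rewrite ler0n.
rewrite ger0_norm //; apply: le_trans wX; rewrite ler_nat leq_mul2l /=.
rewrite /vertex_cover_number; case: arg_minnP => [|U _]; last first.
  apply; apply/forallP=> x; apply/forallP=> y; apply/implyP=> xy.
  by apply: Tcov; rewrite ?inE.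
by apply/forallP=> x; apply/forallP=> y; rewrite !inE implybT.
Qed.
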